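(* For any constant $\epsilon>0$, for all sufficiently large $h$ the complete binary tree $Bt_h$ (with $n=2^h-1$ nodes) admits a persistent reversible pebbling using at most $(1+\epsilon)h$ pebbles and at most $n^{O(\log(1/\epsilon))}$ steps.
   Context: $Bt_h$ denotes the complete binary tree of height $h$ (height = number of nodes on a root-to-leaf path), with edges directed from child to parent, so the root is the unique sink. A persistent reversible pebbling of a directed acyclic graph $G$ with unique sink $r$ is a sequence $P_1,\dots,P_m$ of vertex subsets with $P_1=\emptyset$, $P_m=\{r\}$, such that each $P_i$ ($i\ge2$) is obtained from $P_{i-1}$ by adding or removing exactly one vertex $v$, all of whose in-neighbours lie in $P_{i-1}$. Its number of pebbles is $\max_i|P_i|$ and its number of steps is $m$. *)

(* Defs.v *)
From mathcomp Require Import all_boot.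

Set Implicit Arguments.
Unset Strict Implicit.
Unset Printing Implicit Defensive.

(* A finite digraph is a relation [e] on a finType [V], [e u v] meaning that
   there is an edge directed from [u] to [v]. *)
Section ReversiblePebbling.
Variables (V : finType) (e : rel V).

Definition unique_sink (r : V) : Prop :=
  forall v, [forall w, ~~ e v w] = (v == r).

Definition pebble_move (P Q : {set V}) : bool :=
  [exists v, ((v \notin P) && (Q == v |: P) || (v \in P) && (Q == P :\ v))
             && [forall u, e u v ==> (u \in P)]].

(* [Ps] is P_1, ..., P_m; it is nonempty since [ohead Ps = Some set0]. *)
Definition persistent_pebbling (r : V) (Ps : seq {set V}) : Prop :=
  [/\ ohead Ps = Some set0, last set0 Ps = [set r] & sorted pebble_move Ps].

Definition num_pebbles (Ps : seq {set V}) : nat := \max_(P <- Ps) #|P|.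

(* The number of configurations m, not the number m - 1 of moves. *)
Definition num_steps (Ps : seq {set V}) : nat := size Ps.

End ReversiblePebbling.

(* A node of the complete binary tree of height [h >= 1] is given by the word
   of left/right choices leading to it from the root, a word of length
   < [h]; the root is the empty word.  [h = 0] is a junk value: [Bt 0] is [Bt 1]. *)
Definition Bt (h : nat) : finType := {bseq h.-1 of bool}.

Definition Bt_root (h : nat) : Bt h := [bseq].

(* edge from a child [u] to its parent [v] *)
Definition Bt_edge (h : nat) : rel (Bt h) :=
  fun u v => [exists b : bool, val u == rcons (val v) b].

Lemma card_Bt (h : nat) : (0 < h)%N -> #|Bt h| = (2 ^ h - 1)%N.
Proof.
by case: h => // h _; rewrite card_bseq card_bool subn1 predn_exp mul1n.
Qed.

(* Every edge decreases the depth, so the tree is acyclic. *)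
Lemma Bt_edge_size (h : nat) (u v : Bt h) :
  Bt_edge u v -> size u = (size v).+1.
Proof. by case/existsP=> b /eqP ->; rewrite size_rcons. Qed.

Lemma Bt_unique_sink (h : nat) : unique_sink (@Bt_edge h) (Bt_root h).
Proof.
move=> v; apply/forallP/eqP => [noedge | -> w]; last first.
  by apply/negP => /Bt_edge_size.
case: v noedge => v; case/lastP: v => [|s b] sv noedge; apply/val_inj => //=.
have ss : (size s <= h.-1)%N by apply: ltnW; rewrite -(size_rcons s b).
have /negP[] := noedge (Bseq ss).
by apply/existsP; exists b.
Qed.

(* Main.v *)
(* Visiting the root, i.e. reaching a configuration from which it can be pebbled,
   is cheaper than pebbling it persistently: the latter is a visit followed by
   its reversal, and costs one more pebble.  The root of height h + 1 can be
   visited by persistently pebbling one child and then merely visiting the other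
   one.  This raises the maximal number of pebbles by 1 only, but leaves a final
   configuration with 2 more pebbles than before.  Pebbling both children
   persistently raises the maximum by 2, but leaves a configuration of size 2.
   Using the second option exactly when the height reaches a power of 2 keeps
   the final configuration below the maximum, so that h + log2 h + 1 pebbles
   and O(4 ^ h) = O(n ^ 2) steps suffice; the exponent does not even depend on
   epsilon. *)
Require Import Defs.
From mathcomp Require Import all_boot zify.

Set Implicit Arguments.
Unset Strict Implicit.
Unset Printing Implicit Defensive.

(** * Sequences of moves with bounded pebbles and length *)

Section Reach.
Context {V : finType} {e : rel V}.
Implicit Types P Q : {set V}.

(** Adding and removing a vertex are both a symmetric difference with a singleton, so reversing a
    move needs no case split. *)
Lemma pebble_moveP P Q :
  reflect (exists v, (forall w, (w \in Q) = (w \in P) (+) (w == v)) /\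
                     (forall u, e u v -> u \in P))
          (pebble_move e P Q).
Proof.
apply: (iffP existsP) => -[v].
  case/andP=> vPQ /forallP inP; exists v; split=> [w|u]; last exact/implyP/inP.
  case/orP: vPQ => /andP[vP /eqP ->]; rewrite !inE; case: eqP => [->|_] /=.
  - by rewrite (negbTE vP).
  - by rewrite addbF.
  - by rewrite vP.
  - by rewrite addbF.
case=> defQ inP; exists v; apply/andP; split; last first.
  by apply/forallP=> u; apply/implyP; exact: inP.
case: (boolP (v \in P)) => vP; rewrite /= ?orbF; apply/eqP/setP => w;
  rewrite !inE defQ; case: eqP => [->|_] /=; by rewrite ?vP ?(negbTE vP) ?addbF.
Qed.

(** Without loops the moved vertex is not its own in-neighbour, so its in-neighbours keep their
    pebbles across the move. *)
Lemma pebble_move_sym P Q :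
  irreflexive e -> pebble_move e P Q -> pebble_move e Q P.
Proof.
move=> irr /pebble_moveP[v [defQ inP]]; apply/pebble_moveP; exists v.
split=> [w|u euv]; first by rewrite defQ -addbA addbb addbF.
rewrite defQ inP //; case: eqP => // uv.
by rewrite uv irr in euv.
Qed.

(** Here [n] bounds the number of moves, one less than the number of configurations; both [p] and
    [n] are upper bounds only. *)
Definition reach (p n : nat) P Q : Prop :=
  exists s, [/\ path (pebble_move e) P s, last P s = Q, size s <= n
              & all (fun A : {set V} => #|A| <= p) (P :: s)].

Lemma reach_refl p P : #|P| <= p -> reach p 0 P P.
Proof. by move=> Pp; exists [::]; rewrite /= Pp. Qed.

Lemma reach_step p P Q :
  #|P| <= p -> #|Q| <= p -> pebble_move e P Q -> reach p 1 P Q.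
Proof. by move=> Pp Qp PQ; exists [:: Q]; rewrite /= PQ Pp Qp. Qed.

Lemma reach_trans p m n P Q S :
  reach p m P Q -> reach p n Q S -> reach p (m + n) P S.
Proof.
case=> s [ps ls ss /= /andP[Pp as_]] [t [pt lt st /= /andP[Qp at_]]].
exists (s ++ t); split.
- by rewrite cat_path ps ls.
- by rewrite last_cat ls.
- by rewrite size_cat leq_add.
- by rewrite /= Pp all_cat as_ at_.
Qed.

Lemma reach_weaken p p' n n' P Q :
  p <= p' -> n <= n' -> reach p n P Q -> reach p' n' P Q.
Proof.
move=> pp nn [s [ps ls ss as_]]; exists s; split=> //.
  exact: leq_trans nn.
by apply: sub_all as_ => A Ap; apply: leq_trans pp.
Qed.

Lemma reach_sym p n P Q : irreflexive e -> reach p n P Q -> reach p n Q P.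
Proof.
move=> irr [s [ps ls ss as_]]; elim: s P n ps ls ss as_ => [|A s IH] P n /=.
  by move=> _ <- _ /andP[Pp _]; apply: reach_weaken (reach_refl Pp).
case/andP=> PA ps ls; case: n => // n ss /and3P[Pp Ap as_].
rewrite -addn1; apply: (reach_trans (Q := A)).
  by apply: IH => //=; rewrite Ap.
by apply: reach_step => //; apply: pebble_move_sym.
Qed.

Lemma reach_card p n P Q : reach p n P Q -> #|Q| <= p.
Proof. by case=> s [_ <- _ /allP]; apply; apply: mem_last. Qed.

End Reach.
Arguments reach {V} e p n P Q.

Lemma reach_map (V W : finType) (e : rel V) (e' : rel W)
    (f : {set V} -> {set W}) (d p n : nat) (P Q : {set V}) :
    (forall A B, pebble_move e A B -> pebble_move e' (f A) (f B)) ->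
    (forall A, #|f A| <= #|A| + d) ->
  reach e p n P Q -> reach e' (p + d) n (f P) (f Q).
Proof.
move=> f_move f_card [s [ps ls ss as_]]; exists (map f s); split.
- by rewrite path_map; apply: sub_path ps => A B; apply: f_move.
- by rewrite last_map ls.
- by rewrite size_map.
- rewrite -map_cons all_map; apply: sub_all as_ => A /= Ap.
  by apply: leq_trans (f_card A) _; rewrite leq_add2r.
Qed.

(** * The tree as a root above two subtrees, and the recursion on its height *)

Section Tree.

Lemma Bt_edge_irr h : irreflexive (@Bt_edge h).
Proof.
by move=> u; apply/negbTE/negP => /Bt_edge_size /n_Sn.
Qed.

Definition subtree {k} (b : bool) (v : Bt k.+1) : Bt k.+2 :=
  [bseq of b :: v].

Lemma subtree_inj k b : injective (@subtree k b).
Proof. by move=> u v /(congr1 val) [] /val_inj. Qed.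

Lemma subtree_eq k b b' (u v : Bt k.+1) :
  (subtree b u == subtree b' v) = (b == b') && (u == v).
Proof. by []. Qed.

Variant Bt_spec k : Bt k.+2 -> Type :=
  | BtRoot : Bt_spec (Bt_root k.+2)
  | BtSub b v : Bt_spec (subtree b v).

Lemma Bt_case k (u : Bt k.+2) : Bt_spec u.
Proof.
case: u => -[|b v] uP.
  by rewrite (_ : Bseq uP = Bt_root k.+2); [constructor | apply: val_inj].
have vP : size v <= k by [].
rewrite (_ : Bseq uP = subtree b (Bseq vP : Bt k.+1)); first constructor.
exact: val_inj.
Qed.

Lemma Bt_edge_subtree k b b' (u v : Bt k.+1) :
  Bt_edge (subtree b u) (subtree b' v) = (b == b') && Bt_edge u v.
Proof.
apply/existsP/andP => [[c /eqP [-> uv]]|[/eqP <- /existsP[c /eqP uv]]].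
  by split=> //; apply/existsP; exists c; apply/eqP.
by exists c; rewrite /= uv.
Qed.

Lemma Bt_edge_subtree_root k b (u : Bt k.+1) :
  Bt_edge (subtree b u) (Bt_root k.+2) = (u == Bt_root k.+1).
Proof.
apply/existsP/eqP => [[c /eqP [_ u0]]|->]; first exact: val_inj.
by exists b.
Qed.

Lemma Bt_edge_root k (v : Bt k) : Bt_edge (Bt_root k) v = false.
Proof. by apply/negbTE/negP => /Bt_edge_size. Qed.

Definition root_set (k : nat) (x : bool) : {set Bt k} :=
  if x then [set Bt_root k] else set0.

Definition join {k} (x : bool) (A B : {set Bt k.+1}) : {set Bt k.+2} :=
  root_set k.+2 x :|: subtree true @: A :|: subtree false @: B.

Lemma in_join_root k x (A B : {set Bt k.+1}) :
  (Bt_root k.+2 \in join x A B) = x.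
Proof.
rewrite /join !inE.
have nosub b D : (Bt_root k.+2 \in subtree b @: D) = false by apply/imsetP => -[].
by rewrite !nosub !orbF; case: x; rewrite !inE.
Qed.

Lemma in_join_subtree k x (A B : {set Bt k.+1}) b v :
  (subtree b v \in join x A B) = (v \in if b then A else B).
Proof.
rewrite /join !inE.
have -> : (subtree b v \in root_set k.+2 x) = false by case: x; rewrite !inE.
have im c D : (subtree b v \in subtree c @: D) = (b == c) && (v \in D).
  apply/imsetP/andP => [[w wD /eqP]|[/eqP <- vD]]; last by exists v.
  by rewrite subtree_eq => /andP[-> /eqP ->].
by rewrite !im; case: (b); rewrite /= ?orbF.
Qed.

Lemma card_root_set k x : #|root_set k x| = x.
Proof. by case: x; rewrite ?cards1 ?cards0. Qed.

Lemma card_join k x (A B : {set Bt k.+1}) : #|join x A B| <= #|A| + #|B| + x.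
Proof.
rewrite addnC addnA -[X in X + _ + _](card_root_set k.+2).
rewrite -(card_imset A (@subtree_inj k true)) -(card_imset B (@subtree_inj k false)).
apply: leq_trans (leq_card_setU _ _) _; rewrite leq_add2r.
exact: leq_card_setU.
Qed.

Lemma join_root_set k x : join x set0 set0 = root_set k.+2 x.
Proof. by rewrite /join !imset0 !setU0. Qed.

Lemma join_rootU k (A B : {set Bt k.+1}) :
  Bt_root k.+2 |: join false A B = join true A B.
Proof. by rewrite /join /root_set set0U setUA. Qed.

Definition join1 {k} (b x : bool) (B A : {set Bt k.+1}) : {set Bt k.+2} :=
  if b then join x A B else join x B A.

(** All in-neighbours of a vertex of a subtree lie in that subtree, so the root and the other
    subtree cannot block the move. *)
Lemma join1_move k b x (B P Q : {set Bt k.+1}) :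
  pebble_move (@Bt_edge k.+1) P Q ->
  pebble_move (@Bt_edge k.+2) (join1 b x B P) (join1 b x B Q).
Proof.
case/pebble_moveP=> v [defQ inP]; apply/pebble_moveP; exists (subtree b v).
have inj c D w : (subtree c w \in join1 b x B D) = (w \in if c == b then D else B).
  by case: (b) c => -[]; rewrite in_join_subtree.
have inr D : (Bt_root k.+2 \in join1 b x B D) = x by case: (b); rewrite in_join_root.
split=> [w|u].
  case: (Bt_case w) => [|c {}w]; first by rewrite !inr addbF.
  by rewrite !inj subtree_eq; case: eqP => _ /=; rewrite ?defQ ?addbF.
case: (Bt_case u) => [|c {}u]; first by rewrite Bt_edge_root.
by rewrite Bt_edge_subtree inj => /andP[-> /inP].
Qed.

Lemma card_join1 k b x (B A : {set Bt k.+1}) :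
  #|join1 b x B A| <= #|A| + (#|B| + x).
Proof.
by rewrite addnA /join1; case: b; rewrite ?card_join // [#|A| + _]addnC card_join.
Qed.

Lemma reach_join1 k b (x : bool) (B : {set Bt k.+1}) p q n (P Q : {set Bt k.+1}) :
    reach (@Bt_edge k.+1) p n P Q -> p + (#|B| + x) <= q ->
  reach (@Bt_edge k.+2) q n (join1 b x B P) (join1 b x B Q).
Proof.
move=> PQ pq; apply: reach_weaken pq (leqnn n) _.
by apply: reach_map PQ => [C D|C]; [apply: join1_move | apply: card_join1].
Qed.

(* The sequence is required to work also in presence of a pebble on the root,
   since it is run backwards after the root has been pebbled. *)
Definition visit (h p c n : nat) : Prop :=
  exists C : {set Bt h},
    [/\ pebble_move (@Bt_edge h) C (Bt_root h |: C), #|C| <= c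
      & forall x : bool, reach (@Bt_edge h) (p + x) n (root_set h x) (root_set h x :|: C)].

Lemma visit_weaken h p p' c c' n n' :
  p <= p' -> c <= c' -> n <= n' -> visit h p c n -> visit h p' c' n'.
Proof.
move=> pp cc nn [C [mC Cc rC]]; exists C; split=> // [|x].
  exact: leq_trans cc.
by apply: reach_weaken (rC x) => //; rewrite leq_add2r.
Qed.

Definition persist (h p n : nat) : Prop :=
  reach (@Bt_edge h) p n set0 [set Bt_root h].

(** The instance [x = false] is run forwards, the root is pebbled, and the instance [x = true] is
    run backwards. *)
Lemma visit_persist h p c n : visit h p c n -> persist h p.+1 (n.*2).+1.
Proof.
case=> C [mC _ rC]; have := rC true; have := rC false.
rewrite /root_set set0U addn0 addn1 => r0 r1.
have -> : (n.*2).+1 = n + 1 + n by lia.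
apply: (reach_trans (Q := Bt_root h |: C)).
  apply: (reach_trans (Q := C)); first exact: reach_weaken r0.
  apply: reach_step mC; last exact: reach_card r1.
  exact/leqW/reach_card/r0.
exact: reach_sym (@Bt_edge_irr h) r1.
Qed.

Lemma visit_leaf : visit 1 0 0 0.
Proof.
exists set0; split=> [||x]; rewrite ?cards0 //.
  apply/pebble_moveP; exists (Bt_root 1); split=> [w|u].
    by rewrite !inE orbF.
  by move=> /Bt_edge_size; case: u => -[].
by rewrite setU0; apply: reach_refl; rewrite card_root_set.
Qed.

(* The left child gets pebbled persistently, and then D is reached in the
   right subtree. *)
Lemma visit_join k p q m n (D : {set Bt k.+1}) :
    Bt_root k.+1 \in D -> persist k.+1 p m ->
    reach (@Bt_edge k.+1) q n set0 D ->
  visit k.+2 (maxn p q.+1) #|D|.+1 (m + n).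
Proof.
move=> rD rA rB; exists (join false [set Bt_root k.+1] D); split.
- rewrite join_rootU; apply/pebble_moveP; exists (Bt_root k.+2); split=> [w|u].
    case: (Bt_case w) => [|b v]; first by rewrite !in_join_root eqxx.
    by rewrite !in_join_subtree addbF.
  case: (Bt_case u) => [|b v]; first by rewrite Bt_edge_root.
  by rewrite Bt_edge_subtree_root in_join_subtree => /eqP ->; case: b; rewrite ?inE.
- by rewrite (leq_trans (card_join _ _ _)) // cards1 addn0 add1n.
move=> x; have -> : root_set k.+2 x :|: join false [set Bt_root k.+1] D
    = join x [set Bt_root k.+1] D.
  by rewrite /join set0U setUA.
rewrite -join_root_set; apply: (reach_trans (Q := join x [set Bt_root k.+1] set0)).
  apply: (reach_join1 true (x := x) (B := set0) rA).
  by rewrite cards0 add0n leq_add2r leq_maxl.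
apply: (reach_join1 false (x := x) (B := [set Bt_root k.+1]) rB).
by rewrite cards1 addnA addn1 leq_add2r leq_maxr.
Qed.

Lemma visit_persist_both k p c n :
  visit k.+1 p c n -> visit k.+2 p.+2 2 (4 * n + 2).
Proof.
move=> /visit_persist pn.
have := visit_join (set11 _) pn pn.
by rewrite cards1; apply: visit_weaken; rewrite // ?geq_max ?leqnn ?leqnSn //; lia.
Qed.

(** The right child is visited and then pebbled; [c < p] makes this last pebble fit within [p]. The
    [3 * n + 2] moves are rounded up to the count of [visit_persist_both], so that one recurrence
    serves both options. *)
Lemma visit_persist_visit k p c n :
  c < p -> visit k.+1 p c n -> visit k.+2 p.+1 c.+2 (4 * n + 2).
Proof.
move=> cp vis; have pn := visit_persist vis.
case: vis => C [mC Cc /(_ false)]; rewrite addn0 set0U => r0.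
have cD : #|Bt_root k.+1 |: C| <= c.+1.
  by rewrite cardsU1 (leq_add (leq_b1 _) Cc).
have r1 : reach (@Bt_edge k.+1) p n.+1 set0 (Bt_root k.+1 |: C).
  rewrite -(addn1 n); apply: (reach_trans r0); apply: reach_step mC.
    exact: reach_card r0.
  exact: leq_trans cp.
have := visit_join (setU11 _ _) pn r1.
by apply: visit_weaken; rewrite // ?maxnn //; lia.
Qed.

(** Here [s] is the integer part of log2 [h]. The final configuration restarts at 2 at each power of
    2 and then gains 2 per level; [(4 ^ h).-1] dominates the recurrence that sends [n] to
    [4 * n + 2]. *)
Lemma visit_Bt h s :
  2 ^ s <= h < 2 ^ s.+1 -> visit h (h + s) (2 * (h - 2 ^ s) + 2) (4 ^ h).-1.
Proof.
case: h => [|h]; first by rewrite leqn0 expn_eq0.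
elim: h s => [|h IH] [|s] /andP[lo up].
- by apply: visit_weaken visit_leaf.
- by have := @leq_pexp2l 2 1 s.+1 isT isT; lia.
- by [].
have n_ok : 4 * (4 ^ h.+1).-1 + 2 <= (4 ^ h.+2).-1.
  by have := expn_gt0 4 h.+1; rewrite (expnS 4 h.+1); lia.
have p2 : 2 ^ s.+1 = 2 * 2 ^ s by rewrite expnS.
have p3 : 2 ^ s.+2 = 2 * 2 ^ s.+1 by rewrite expnS.
(* In the second case [h.+2] is exactly [2 ^ s.+1]: both children are pebbled persistently, and the
   second extra pebble is paid for by the logarithm growing by 1. *)
case: (leqP (2 ^ s.+1) h.+1) => [le|lt].
  have /IH vis : 2 ^ s.+1 <= h.+1 < 2 ^ s.+2 by lia.
  (* This rests on [h.+2 < 2 ^ s.+2]: the final configuration is cut back before it catches up with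
     the maximum. *)
  have lt_cp : 2 * (h.+1 - 2 ^ s.+1) + 2 < h.+1 + s.+1 by lia.
  by apply: visit_weaken (visit_persist_visit lt_cp vis); lia.
have /IH vis : 2 ^ s <= h.+1 < 2 ^ s.+1 by lia.
by apply: visit_weaken (visit_persist_both vis); lia.
Qed.

Lemma persistent_pebbling_Bt h : 0 < h ->
  exists Ps : seq {set Bt h},
    [/\ persistent_pebbling (@Bt_edge h) (Bt_root h) Ps,
        num_pebbles Ps <= h + (trunc_log 2 h).+1
      & num_steps Ps <= 2 * 4 ^ h].
Proof.
move=> h0; have /visit_Bt/visit_persist : 2 ^ trunc_log 2 h <= h < 2 ^ (trunc_log 2 h).+1.
  by rewrite trunc_logP // trunc_log_ltn.
case=> s [ps ls ss as_]; exists (set0 :: s); split.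
- by split.
- by apply/bigmax_leqP_seq => A As _; rewrite addnS; move/allP: as_; apply.
(* There are at most [2 * (4 ^ h - 1) + 1] moves, and the initial configuration adds 1. *)
- by rewrite /num_steps /=; have := expn_gt0 4 h; lia.
Qed.

(** A square-root bound on the logarithm is enough to place it below [eps * h], and its squared form
    avoids roots. *)
Lemma trunc_log2_sqr h : 0 < h -> (trunc_log 2 h).+1 ^ 2 <= 4 * h.
Proof.
move=> h0; apply: (@leq_trans (4 * 2 ^ trunc_log 2 h)); last first.
  by rewrite leq_mul2l trunc_logP.
case: (trunc_log 2 h) => [|[|s]] //.
by elim: s => // s IH; rewrite (expnS 2 s.+2); nia.
Qed.

Lemma pow4_le_card_pow4 h : 3 <= h -> 2 * 4 ^ h <= (2 ^ h - 1) ^ 4.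
Proof.
move=> h3; have h8 : 2 ^ 3 <= 2 ^ h by rewrite leq_pexp2l.
have -> : 4 ^ h = 2 ^ h * 2 ^ h by rewrite -expnMn.
move: (2 ^ h) h8 => a; case: a => // a h8; rewrite subn1 /=.
have -> : a ^ 4 = (a * a) * (a * a) by rewrite !expnS expn0 muln1 !mulnA.
(* Now [a] stands for [2 ^ h - 1], which is at least 7, whence the constant 49. *)
by apply: (@leq_trans (49 * (a * a))); nia.
Qed.

End Tree.

(* The asymptotic statement over the reals *)
From mathcomp Require Import all_boot all_order all_algebra.
From mathcomp Require Import all_classical all_reals all_analysis.

Import Order.TTheory GRing.Theory Num.Theory.
Import numFieldNormedType.Exports.

Local Open Scope classical_set_scope.
Local Open Scope ring_scope.

Theorem mainTheorem9 (R : realType) :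
  exists f : R -> R,
    f =O_ (0^'+) (fun eps : R => ln (1 / eps)) /\
    forall eps : R, 0 < eps ->
      \forall h \near \oo, exists Ps : seq {set Bt h},
        [/\ persistent_pebbling (@Bt_edge h) (Bt_root h) Ps,
            (num_pebbles Ps)%:R <= (1 + eps) * h%:R
          & (num_steps Ps)%:R <= (2 ^ h - 1)%N%:R `^ (f eps)].
Proof.
(* A constant exponent is O(ln (1 / eps)) at 0+, since ln (1 / eps) is at least 1 once eps < 1/e. *)
exists (fun=> 4%:R); split.
  apply/eqO_exP; exists 4%:R; first by [].
  near=> x.
  have x0 : 0 < x by near: x; exact: nbhs_right_gt.
  have xe : x < expR (-1) by near: x; apply: nbhs_right_lt; exact: expR_gt0.
  have l1 : 1 <= ln (1 / x).
    rewrite div1r lnV ?posrE // lerNr -(expRK (-1)) ler_ln ?posrE ?expR_gt0 //.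
    exact: ltW.
  by rewrite ger0_norm // ger0_norm ?ler_peMr // (le_trans ler01).
move=> eps eps0; near=> h.
have h3 : (3 <= h)%N by near: h; exact: nbhs_infty_ge.
have h0 : (0 < h)%N by exact: leq_trans h3.
have hR : 0 < h%:R :> R by rewrite ltr0n.
(* From this threshold on, 4 h is at most (eps h)^2, so [trunc_log2_sqr] bounds the logarithmic term
   by eps h. *)
have heps : 4 / eps ^+ 2 <= h%:R by near: h; exact: nbhs_infty_ger.
have [Ps [pers peb steps]] := persistent_pebbling_Bt h0.
exists Ps; split=> //.
  apply: (@le_trans _ _ (h + (trunc_log 2 h).+1)%N%:R); first by rewrite ler_nat.
  rewrite natrD mulrDl mul1r lerD2l -ler_sqr ?nnegrE ?mulr_ge0 ?(ltW eps0) //.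
  apply: (@le_trans _ _ (4 * h)%N%:R).
    by rewrite -natrX ler_nat trunc_log2_sqr.
  rewrite ler_pdivrMr ?exprn_gt0 // in heps.
  by rewrite exprMn natrM [h%:R ^+ 2]expr2 mulrA ler_pM2r // mulrC.
rewrite powR_mulrn ?ler0n // -natrX ler_nat.
exact: leq_trans steps (pow4_le_card_pow4 h3).
Unshelve. all: by end_near.
Qed.
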